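(* Let $(R,\mathfrak m)$ be a $1$-dimensional complete local domain with fraction field $Q$. Let $B$ and $B'$ be torsion-free $R$-modules of finite rank. Suppose $H^1_{\mathfrak m}(B)\cong H^1_{\mathfrak m}(B')$. Then there exist integers $t,t'\ge 0$ such that $B\oplus Q^{t'}\cong B'\oplus Q^{t}$. In particular, if $B$ and $B'$ have the same rank, then $B\cong B'$.
   Context: Rings are commutative and noetherian; complete means complete in the $\mathfrak m$-adic topology. The rank of a torsion-free $R$-module $B$ is $\dim_Q(B\otimes_R Q)$. The modules are not assumed finitely generated. $H^1_{\mathfrak m}(-)$ denotes first local cohomology with support in $\mathfrak m$. *)

(* Defs.v *)
From HB Require Import structures.
From mathcomp Require Import all_boot all_algebra.
From mathcomp Require Import boolp.

Set Implicit Arguments.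
Unset Strict Implicit.
Unset Printing Implicit Defensive.

Import GRing.Theory.
Local Open Scope ring_scope.
Local Open Scope quotient_scope.

(** * Modules *)

Definition lmod_iso (R : pzRingType) (M N : lmodType R) : Prop :=
  exists f : {linear M -> N}, bijective f.

Definition torsion_free (R : idomainType) (M : lmodType R) : Prop :=
  forall (r : R) (x : M), r *: x = 0 -> r = 0 \/ x = 0.

Definition submod_of (R : pzRingType) (M : lmodType R) (S : submodClosed M) :=
  {x : M | x \in S}.

HB.instance Definition _ (R : pzRingType) (M : lmodType R)
  (S : submodClosed M) := SubChoice.on (submod_of S).
HB.instance Definition _ (R : pzRingType) (M : lmodType R)
  (S : submodClosed M) := [SubChoice_isSubLmodule of submod_of S by <:].

(* MathComp's [submodClosed], phrased over semirings, does not inherit from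
   [zmodClosed], which [Quotient.quot] requires; and [Quotient.quot] only
   carries an additive group structure. *)
Definition submod_pred (R : pzRingType) (M : lmodType R) (S : submodClosed M) :
  {pred M} := S.

Fact submod_pred_zmod_closed (R : pzRingType) (M : lmodType R)
  (S : submodClosed M) : zmod_closed (submod_pred S).
Proof.
split; first exact: (rpred0 S).
by move=> x y xS yS; rewrite -scaleN1r; apply: (@rpredD _ S) => //; apply: (@rpredZ _ _ S).
Qed.

HB.instance Definition _ (R : pzRingType) (M : lmodType R)
  (S : submodClosed M) := GRing.isZmodClosed.Build M (submod_pred S)
  (submod_pred_zmod_closed S).

Definition quot_mod (R : pzRingType) (M : lmodType R) (S : submodClosed M) :=
  Quotient.quot (submod_pred S).

Section QuotientModule.
Variables (R : pzRingType) (M : lmodType R) (S : submodClosed M).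
Local Notation Q := (Quotient.quot (submod_pred S)).

HB.instance Definition _ := GRing.Zmodule.on (quot_mod S).

Definition quot_proj (x : M) : quot_mod S := \pi_Q x.

Definition quot_scale (a : R) (x : quot_mod S) : quot_mod S :=
  quot_proj (a *: repr (x : Q)).

Fact quot_projK (x : quot_mod S) : quot_proj (repr (x : Q)) = x.
Proof. exact: reprK. Qed.

Fact quot_projD x y : quot_proj (x + y) = quot_proj x + quot_proj y.
Proof. exact: (raddfD \pi_Q). Qed.

Fact quot_scale_proj a x : quot_scale a (quot_proj x) = quot_proj (a *: x).
Proof.
apply/eqP; rewrite /quot_scale /quot_proj -Quotient.idealrBE -scalerBr.
by apply: (@rpredZ _ _ S); rewrite (Quotient.idealrBE (submod_pred S)) reprK.
Qed.

Fact quot_scaleA a b x : quot_scale a (quot_scale b x) = quot_scale (a * b) x.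
Proof. by rewrite -[x]quot_projK !quot_scale_proj scalerA. Qed.

Fact quot_scale1 : left_id 1 quot_scale.
Proof. by move=> x; rewrite -[x]quot_projK !quot_scale_proj scale1r. Qed.

Fact quot_scaleDr : right_distributive quot_scale +%R.
Proof.
move=> a x y; rewrite -[x]quot_projK -[y]quot_projK.
by rewrite -quot_projD !quot_scale_proj scalerDr quot_projD.
Qed.

Fact quot_scaleDl x : {morph quot_scale^~ x : a b / a + b}.
Proof.
by move=> a b; rewrite -[x]quot_projK !quot_scale_proj scalerDl quot_projD.
Qed.

HB.instance Definition _ := GRing.Zmodule_isLmodule.Build R (quot_mod S)
  quot_scaleA quot_scale1 quot_scaleDr quot_scaleDl.

End QuotientModule.

(* The fraction field of [R], viewed as an [R]-module. *)
Definition frac_mod (R : idomainType) := {fraction R}.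

Section FractionModule.
Variable R : idomainType.

HB.instance Definition _ := GRing.Zmodule.on (frac_mod R).

Definition frac_scale (r : R) (q : frac_mod R) : frac_mod R :=
  (tofrac r * q : {fraction R}).

Fact frac_scaleA a b q : frac_scale a (frac_scale b q) = frac_scale (a * b) q.
Proof. by rewrite /frac_scale rmorphM mulrA. Qed.

Fact frac_scale1 : left_id 1 frac_scale.
Proof. by move=> q; rewrite /frac_scale rmorph1 mul1r. Qed.

Fact frac_scaleDr : right_distributive frac_scale +%R.
Proof. by move=> a x y; rewrite /frac_scale -mulrDr. Qed.

Fact frac_scaleDl q : {morph frac_scale^~ q : a b / a + b}.
Proof. by move=> a b; rewrite /frac_scale rmorphD mulrDl. Qed.

HB.instance Definition _ := GRing.Zmodule_isLmodule.Build R (frac_mod R)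
  frac_scaleA frac_scale1 frac_scaleDr frac_scaleDl.

End FractionModule.

(** * Rings *)

(* [idealr R] is the type of proper ideals; the unit ideal is always
   generated by 1. *)
Definition noetherian (R : comNzRingType) : Prop :=
  forall I : idealr R, exists s : seq R,
    forall x, x \in I <-> exists c : 'I_(size s) -> R, x = \sum_i c i * s`_i.

Definition maximal_ideal (R : comNzRingType) (I : idealr R) : Prop :=
  forall J : idealr R, {subset I <= J} -> J =i I.

Definition local_ring (R : comNzRingType) (m : idealr R) : Prop :=
  maximal_ideal m /\ forall J : idealr R, maximal_ideal J -> J =i m.

(* A strictly increasing chain of primes P_0 < P_1 < ... < P_d. *)
Definition prime_chain (R : comNzRingType) (d : nat)
    (P : 'I_d.+1 -> prime_idealr R) : Prop :=
  forall i j : 'I_d.+1, (i < j)%N ->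
    {subset P i <= P j} /\ ~ {subset P j <= P i}.

Definition krull_dim (R : comNzRingType) (d : nat) : Prop :=
  (exists P : 'I_d.+1 -> prime_idealr R, prime_chain P) /\
  (forall e (P : 'I_e.+1 -> prime_idealr R), prime_chain P -> (e <= d)%N).

(* I^n, the ideal generated by the products of n elements of I. *)
Definition ideal_pow (R : comNzRingType) (I : {pred R}) (n : nat) : {pred R} :=
  fun x => `[< exists (k : nat) (c : 'I_k -> R) (a : 'I_k -> 'I_n -> R),
    (forall i j, a i j \in I) /\ x = \sum_i c i * \prod_j a i j >].

(* The canonical map from R to the inverse limit of the R / I^n is
   bijective. *)
Definition adic_complete (R : comNzRingType) (I : {pred R}) : Prop :=
  forall x : nat -> R, (forall n, x n.+1 - x n \in ideal_pow I n) ->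
  exists l : R, (forall n, l - x n \in ideal_pow I n) /\
    forall l' : R, (forall n, l' - x n \in ideal_pow I n) -> l' = l.

(** * Rank *)

Definition balanced (R : comNzRingType) (M N : lmodType R) (W : zmodType)
    (f : M -> N -> W) : Prop :=
  [/\ forall x x' y, f (x + x') y = f x y + f x' y,
      forall x y y', f x (y + y') = f x y + f x y'
    & forall (r : R) x y, f (r *: x) y = f x (r *: y)].

(* (T, t) is the tensor product of M and N over R. *)
Definition is_tensor (R : comNzRingType) (M N : lmodType R) (T : zmodType)
    (t : M -> N -> T) : Prop :=
  balanced t /\
  forall (W : zmodType) (f : M -> N -> W), balanced f ->
    exists g : {additive T -> W}, (forall x y, g (t x y) = f x y) /\
      forall g' : {additive T -> W}, (forall x y, g' (t x y) = f x y) ->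
        g' =1 g.

(* dim_Q (M (x)_R Q) = n, where Q acts on the second tensor factor; in
   particular this dimension is finite. *)
Definition has_rank (R : idomainType) (M : lmodType R) (n : nat) : Prop :=
  exists (T : vectType {fraction R}) (t : M -> frac_mod R -> T),
    [/\ is_tensor t,
        forall (x : M) (p q : {fraction R}), t x (p * q) = p *: t x q
      & \dim {: T} = n].

(** * Local cohomology *)

Definition injective_module (R : pzRingType) (E : lmodType R) : Prop :=
  forall (M N : lmodType R) (i : {linear M -> N}) (f : {linear M -> E}),
    injective i -> exists g : {linear N -> E}, forall x, g (i x) = f x.

Record inj_resolution (R : pzRingType) (M : lmodType R) := InjResolution {
  res_obj : nat -> lmodType R;
  res_aug : {linear M -> res_obj 0};
  res_diff : forall n, {linear res_obj n -> res_obj n.+1};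
  res_injective : forall n, injective_module (res_obj n);
  res_aug_inj : injective res_aug;
  res_exact0 : forall x, res_diff 0 x = 0 <-> exists y, x = res_aug y;
  res_exactS : forall n x,
    res_diff n.+1 x = 0 <-> exists y, x = res_diff n y
}.

Section Gamma.
Variables (R : comNzRingType) (I : {pred R}).

(* The elements of M killed by some power of I. *)
Definition gamma_pred (M : lmodType R) : {pred M} :=
  fun x => `[< exists n, forall a, a \in ideal_pow I n -> a *: x = 0 >].

Fact ideal_pow_add n k a :
  a \in ideal_pow I (n + k) -> (a \in ideal_pow I n) && (a \in ideal_pow I k).
Proof.
move=> /asboolP [l [c [f [fI ->]]]]; apply/andP; split; apply/asboolP; exists l.
  exists (fun i => c i * \prod_j f i (rshift n j)), (fun i j => f i (lshift k j)).
  split=> //; apply: eq_bigr => i _.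
  by rewrite big_split_ord /= mulrA mulrAC.
exists (fun i => c i * \prod_j f i (lshift k j)), (fun i j => f i (rshift n j)).
by split=> //; apply: eq_bigr => i _; rewrite big_split_ord /= mulrA.
Qed.

Fact gamma_submod_closed (M : lmodType R) : submod_closed (@gamma_pred M).
Proof.
split; first by apply/asboolP; exists 0%N => a _; rewrite scaler0.
move=> b x y /asboolP [n xn] /asboolP [k yk]; apply/asboolP.
exists (n + k)%N => a /ideal_pow_add /andP [an ak].
by rewrite scalerDr scalerA mulrC -scalerA xn // yk // scaler0 addr0.
Qed.

HB.instance Definition _ (M : lmodType R) :=
  GRing.isSubmodClosed.Build R M (@gamma_pred M) (gamma_submod_closed M).

Definition Gamma (M : lmodType R) : lmodType R := submod_of (@gamma_pred M).

Section GammaMap.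
Variables (M N : lmodType R) (f : {linear M -> N}).

Fact Gamma_map_subproof (x : Gamma M) : f (val x) \in @gamma_pred N.
Proof.
case: x => x /= /asboolP [n xn]; apply/asboolP; exists n => a an.
by rewrite -linearZ xn // linear0.
Qed.

Definition Gamma_map (x : Gamma M) : Gamma N :=
  Sub (f (val x)) (Gamma_map_subproof x).

Fact Gamma_map_linear : linear Gamma_map.
Proof. by move=> a x y; apply: val_inj; rewrite /= linearP. Qed.

HB.instance Definition _ :=
  GRing.isLinear.Build R (Gamma M) (Gamma N) *:%R Gamma_map Gamma_map_linear.

End GammaMap.
End Gamma.

Arguments Gamma_map {R} I {M N} f.

Section Cohomology.
Variables (R : pzRingType) (C : nat -> lmodType R).
Variable d : forall n, {linear C n -> C n.+1}.

Definition cocycle (n : nat) : {pred C n} := fun x => d n x == 0.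

Fact cocycle_submod_closed n : submod_closed (@cocycle n).
Proof.
split; first by rewrite unfold_in linear0.
move=> a x y /eqP xZ /eqP yZ.
by rewrite unfold_in linearP xZ yZ scaler0 addr0.
Qed.

HB.instance Definition _ n :=
  GRing.isSubmodClosed.Build R (C n) (@cocycle n) (cocycle_submod_closed n).

Definition cocycles (n : nat) : lmodType R := submod_of (@cocycle n).

Definition is_boundary (n : nat) : C n -> Prop :=
  match n with
  | 0 => fun x => x = 0
  | k.+1 => fun x => exists y : C k, x = d k y
  end.

Definition coboundary (n : nat) : {pred cocycles n} :=
  fun x => `[< is_boundary (val x) >].

Fact coboundary_submod_closed n : submod_closed (@coboundary n).
Proof.
split; first apply/asboolP.
  by case: n => [//|n] /=; exists 0; rewrite linear0.
move=> a x y /asboolP xB /asboolP yB; apply/asboolP.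
case: n x y xB yB => [|n] x y /=; first by move=> -> ->; rewrite scaler0 addr0.
by move=> [u ->] [v ->]; exists (a *: u + v); rewrite linearP.
Qed.

HB.instance Definition _ n := GRing.isSubmodClosed.Build R (cocycles n)
  (@coboundary n) (coboundary_submod_closed n).

Definition cohomology (n : nat) : lmodType R := quot_mod (@coboundary n).

End Cohomology.

(* H^n_I (M), the n-th right derived functor of Gamma_I at M, computed from a
   given injective resolution; up to isomorphism it does not depend on the
   resolution. *)
Definition local_cohomology (R : comNzRingType) (I : {pred R})
    (M : lmodType R) (E : inj_resolution M) (n : nat) : lmodType R :=
  cohomology (fun k => Gamma_map I (res_diff E k) : {linear _ -> _}) n.

(* Main.v *)
(** Let [Q] be the fraction field of [R] and [V = B (x) Q].  As [V] has no local
    cohomology and [V / B] is [m]-torsion, [H^1_m(B) = V / B].  Fix a nonzero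
    [x] in [m], so that [Q = R[1/x]].  Every [R]-submodule of a
    finite-dimensional [Q]-space is [x]-adically complete: filtering by lines
    reduces this to rank one, where it follows from the completeness of [R] and
    from the descending chain condition for ideals containing [x].
    Consequently every [R]-linear map [V -> V' / B'] lifts along
    [V' -> V' / B'] to a [Q]-linear map.  For an isomorphism
    [V / B ~= V' / B'] the pairs [(v, v')] with [phi (q v) = q v' mod B'] for
    all [q] in [Q] thus form a [Q]-linear relation that is total on both sides;
    when [dim V = dim V'] it contains the graph of a bijection, and this
    bijection maps [B] onto [B'].  Adding copies of [Q], which does not change
    [H^1_m], equalizes the ranks. *)

Require Import Defs.
From HB Require Import structures.
From mathcomp Require Import all_boot all_algebra.
From mathcomp Require Import boolp ring.

Set Implicit Arguments.
Unset Strict Implicit.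
Unset Printing Implicit Defensive.

Import GRing.Theory.
Local Open Scope ring_scope.

(** * Ideals of a one-dimensional noetherian local domain *)

Section Ideals.
Variable R : comNzRingType.
Implicit Types I J : R -> Prop.

(** Unlike [idealr], this admits the unit ideal, which sums and quotients of ideals may reach. *)
Definition ideal I := I 0 /\ forall a u v, I u -> I v -> I (a * u + v).

Lemma idealD I u v : ideal I -> I u -> I v -> I (u + v).
Proof. by move=> [_ Ic] uI vI; rewrite -[u]mul1r; apply: Ic. Qed.

Lemma idealM I a u : ideal I -> I u -> I (a * u).
Proof. by move=> [I0 Ic] uI; rewrite -[_ * _]addr0; apply: Ic. Qed.

Lemma ideal_sum I n (F : 'I_n -> R) : ideal I -> (forall i, I (F i)) -> I (\sum_i F i).
Proof.
by move=> II FI; elim/big_ind: _ => //; [case: II | move=> u v; apply: idealD].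
Qed.

Definition ideal_add I (a : R) : R -> Prop := fun u => exists i r, I i /\ u = i + r * a.
Definition ideal_quo I (a : R) : R -> Prop := fun u => I (u * a).

Lemma ideal_addP I a : ideal I -> ideal (ideal_add I a).
Proof.
move=> [I0 Ic]; split; first by exists 0, 0; rewrite mul0r addr0.
move=> b _ _ [i [r [iI ->]]] [j [s [jI ->]]].
by exists (b * i + j), (b * r + s); split; [apply: Ic | ring].
Qed.

Lemma ideal_quoP I a : ideal I -> ideal (ideal_quo I a).
Proof.
move=> [I0 Ic]; split; first by rewrite /ideal_quo mul0r.
by move=> b u v uI vI; rewrite /ideal_quo mulrDl -mulrA; apply: Ic.
Qed.

Lemma idealr_ideal (I : idealr R) : ideal (fun x => x \in I).
Proof. by split=> [|a u v uI vI]; [apply: rpred0 | rewrite rpredD // idealMr]. Qed.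

Lemma idealr_of_ideal I : ideal I -> ~ I 1 -> exists J : idealr R, forall x, x \in J <-> I x.
Proof.
move=> [I0 Ic] I1.
have Jc : idealr_closed (fun x => `[< I x >]).
  split; first exact/asboolP.
    exact/asboolPn.
  by move=> a u v /asboolP uI /asboolP vI; apply/asboolP/Ic.
pose J : idealr R := HB.pack (fun x => `[< I x >]) (isIdealr.Build R _ Jc).
by exists J => x; split=> [/asboolP|?]; last exact/asboolP.
Qed.

Hypothesis hnoeth : noetherian R.

(** Generation is tested on the ideals [J] that contain [s], which avoids coefficients. *)
Lemma ideal_finite I : ideal I -> exists s : seq R, (forall y, y \in s -> I y) /\
  forall J, ideal J -> (forall y, y \in s -> J y) -> forall x, I x -> J x.
Proof.
move=> II; have [I1|I1] := pselect (I 1).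
  exists [:: 1]; split=> [y|J JJ J1 x _]; first by rewrite inE => /eqP->.
  by rewrite -[x]mulr1; apply: idealM => //; apply: J1; rewrite inE.
have [J JI] := idealr_of_ideal II I1; have [s sP] := hnoeth J.
exists s; split=> [y ys|K KK sK x /JI/sP[c ->]].
  apply/JI/sP; pose k : 'I_(size s) := Ordinal (etrans (index_mem y s) ys).
  exists (fun i => (i == k)%:R); rewrite (bigD1 k) //= eqxx mul1r nth_index //.
  by rewrite big1 ?addr0 // => i /negPf->; rewrite mul0r.
by apply: ideal_sum => // i; apply: idealM => //; apply: sK; rewrite mem_nth.
Qed.

(** A counterexample would start a strictly increasing chain of counterexamples; its union is
    finitely generated, so some term already contains the whole union. *)
Lemma noetherian_ind (P : (R -> Prop) -> Prop) :
  (forall I, ideal I ->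
    (forall J, ideal J -> (forall x, I x -> J x) -> (exists x, J x /\ ~ I x) -> P J) ->
    P I) ->
  forall I, ideal I -> P I.
Proof.
move=> IH I0 II0; apply: contrapT => PI0.
pose bad := {I : R -> Prop | ideal I /\ ~ P I}.
have nextP (I : bad) : {J : bad | (forall x, sval I x -> sval J x) /\
    exists x, sval J x /\ ~ sval I x}.
  apply: cid; case: I => I [II PI] /=; apply: contrapT => noJ.
  apply: PI; apply: IH => // J JJ IJ Jx; apply: contrapT => PJ.
  by apply: noJ; exists (exist _ J (conj JJ PJ)).
pose ch n := iter n (fun c : bad => sval (nextP c)) (exist _ I0 (conj II0 PI0) : bad).
have chS n : forall x, sval (ch n) x -> sval (ch n.+1) x by case: (svalP (nextP (ch n))).
have chle n k x : (n <= k)%N -> sval (ch n) x -> sval (ch k) x.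
  by move=> /subnKC <-; elim: (k - n)%N => [|j IHj] xn;
    rewrite ?addn0 // addnS; apply/chS/IHj.
have chI n : ideal (sval (ch n)) by case: (svalP (ch n)).
have UI : ideal (fun x => exists n, sval (ch n) x).
  split=> [|a u v [n un] [k vk]]; first by exists 0%N; case: (chI 0%N).
  exists (n + k)%N; case: (chI (n + k)%N) => _; apply.
    by apply: chle un; apply: leq_addr.
  by apply: chle vk; apply: leq_addl.
have [s [sU sP]] := ideal_finite UI.
have [k sk] : exists k, forall y, y \in s -> sval (ch k) y.
  elim: s sU {sP} => [|y s IHs] sU; first by exists 0%N.
  have [|k sk] := IHs; first by move=> z zs; apply: sU; rewrite inE zs orbT.
  have [|j yj] := sU y; first by rewrite inE eqxx.
  exists (j + k)%N => z; rewrite inE => /orP[/eqP->|/sk].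
    by apply: chle yj; apply: leq_addr.
  by apply: chle; apply: leq_addl.
have [_ [x [xk1 xk]]] := svalP (nextP (ch k)).
by apply: xk; apply: (sP _ (chI k) sk); exists k.+1.
Qed.

Variable m : idealr R.
Hypothesis hlocal : local_ring m.

(** Noetherian induction takes the place of Zorn's lemma: a proper ideal is either maximal, hence
    [m], or lies strictly inside another proper ideal. *)
Lemma proper_sub_maximal I : ideal I -> ~ I 1 -> forall x, I x -> x \in m.
Proof.
move=> II; elim/noetherian_ind: II => {}I II IH I1 x xI.
have [J JI] := idealr_of_ideal II I1.
have [/hlocal.2 Jm|] := pselect (maximal_ideal J); first by rewrite -Jm; apply/JI.
move=> /existsNP[K] /not_implyP [JK KJ].
have [y yK yJ] : exists2 y, y \in K & y \notin J.
  apply: contrapT => h; apply: KJ => y; apply/idP/idP; last exact: JK.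
  by move=> yK; apply/negP => /negP yJ; apply: h; exists y.
apply: (IH (fun x => x \in K)); first exact: idealr_ideal.
- by move=> z /JI/JK.
- by exists y; split=> // /JI; apply/negP.
- by rewrite idealr1.
- exact/JK/JI.
Qed.

(** If [u] is not in [m], then $m + (u)$ contains 1; multiply by [v]. *)
Lemma maximal_prime : prime_idealr_closed m.
Proof.
move=> u v uvm; apply/orP; have [|um] := boolP (u \in m); [by left | right].
have mI := idealr_ideal m.
have [[i [r [im e]]]|h] := pselect (ideal_add (fun x => x \in m) u 1).
  by rewrite -[v]mul1r e mulrDl -mulrA [i * v]mulrC; apply: rpredD; apply: idealMr.
case/negP: um; apply: (proper_sub_maximal (ideal_addP u mI) h).
by exists 0, 1; rewrite rpred0 mul1r add0r.
Qed.

End Ideals.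

Section OneDimensional.
Variables (R : idomainType) (m : idealr R).
Hypotheses (hnoeth : noetherian R) (hlocal : local_ring m) (hdim : krull_dim R 1).
Implicit Types I J : R -> Prop.

(** Otherwise $0 \subset P \subset m$ would be a strict chain of three primes. *)
Lemma nonzero_prime_maximal (P : prime_idealr R) (x : R) :
  x != 0 -> x \in P -> P =i m.
Proof.
move=> x0 xP; have Pm : {subset P <= m}.
  by apply: (proper_sub_maximal hnoeth hlocal (idealr_ideal P)); rewrite idealr1.
apply: contrapT => Pnm.
have mP : ~ {subset m <= P}.
  by move=> mP; apply: Pnm => z; apply/idP/idP; [apply: Pm | apply: mP].
have Zc : idealr_closed (fun z : R => z == 0).
  split; rewrite ?unfold_in ?oner_eq0 // => a u v.
  by rewrite !unfold_in => /eqP-> /eqP->; rewrite mulr0 addr0.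
have Zp : prime_idealr_closed (fun z : R => z == 0) by move=> u v; rewrite !unfold_in mulf_eq0.
pose Z : prime_idealr R := HB.pack (fun z : R => z == 0) (isIdealr.Build R _ Zc)
  (isPrimeIdealrClosed.Build R _ Zp).
pose M : prime_idealr R := HB.pack (m : R -> bool) (Idealr.on m)
  (isPrimeIdealrClosed.Build R _ (maximal_prime hnoeth hlocal)).
pose ch (i : 'I_3) : prime_idealr R :=
  match val i with 0 => Z | 1 => P | _ => M end.
have ZP : {subset Z <= P} by move=> z /eqP->; apply: rpred0.
have PZ : ~ {subset P <= Z} by move=> /(_ x xP); rewrite unfold_in (negPf x0).
suff /hdim.2 : prime_chain ch by [].
move=> [[|[|[|//]]] hi] [[|[|[|//]]] hj] //= _; split=> //.
  by move=> z /ZP/Pm.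
by move=> MZ; apply: PZ => z /Pm/MZ.
Qed.

Lemma exists_maximal_nonzero : exists2 x, x \in m & x != 0.
Proof.
have [P chP] := hdim.1; have [_ h] := chP ord0 ord_max isT.
have [x xP xP0] : exists2 x, x \in P ord_max & x \notin P ord0.
  apply: contrapT => nx; apply: h => y yP; apply/negP => /negP yP0.
  by apply: nx; exists y.
exists x; last by apply: contra xP0 => /eqP->; apply: rpred0.
by apply: (proper_sub_maximal hnoeth hlocal (idealr_ideal (P ord_max)));
  rewrite ?idealr1.
Qed.

(* Dévissage: [0 -> R/(I : a) -> R/I -> R/(I + (a)) -> 0] is exact. *)
Lemma devissage (P : (R -> Prop) -> Prop) :
  P (fun=> True) -> P (fun x => x \in m) ->
  (forall I a, ideal I -> P (ideal_add I a) -> P (ideal_quo I a) -> P I) ->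
  forall I x, ideal I -> I x -> x != 0 -> P I.
Proof.
move=> P1 Pm Pdev I x II Ix x0.
elim/(noetherian_ind hnoeth): II Ix => {}I II IH Ix.
have [I1|I1] := pselect (I 1).
  suff -> : I = fun=> True by [].
  apply/funext => y; apply/propext; split=> // _.
  by rewrite -[y]mulr1; apply: idealM.
have [J JI] := idealr_of_ideal II I1.
have [Jp|] := pselect (prime_idealr_closed J).
  pose Q : prime_idealr R := HB.pack (J : R -> bool) (Idealr.on J)
    (isPrimeIdealrClosed.Build R _ Jp).
  have Qm : Q =i m by apply: (@nonzero_prime_maximal Q x x0); apply/JI.
  suff -> : I = fun y => y \in m by [].
  by apply/funext => y; apply/propext; rewrite -JI -(Qm y).
move=> /existsNP[b] /existsNP[a] /not_implyP[/JI baI] /negP.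
rewrite negb_or => /andP[/negP bJ /negP aJ].
apply: (Pdev I a II); apply: IH.
- exact: ideal_addP.
- by move=> y yI; exists y, 0; rewrite mul0r addr0.
- exists a; split; last by move=> /JI.
  by exists 0, 1; rewrite mul1r add0r; case: II.
- by exists x, 0; rewrite mul0r addr0.
- exact: ideal_quoP.
- by move=> y yI; rewrite /ideal_quo mulrC; apply: idealM.
- by exists b; split=> // /JI.
- by rewrite /ideal_quo mulrC; apply: idealM.
Qed.

(** In the dévissage step, $m^k \subseteq I + (a)$ and $m^l \subseteq (I : a)$ give $m^{k+l}
    \subseteq I$. *)
Lemma ideal_contains_power I x : ideal I -> I x -> x != 0 ->
  exists k, forall a : 'I_k -> R, (forall j, a j \in m) -> I (\prod_j a j).
Proof.
move: I x; apply: devissage.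
- by exists 0%N.
- by exists 1%N => a am; rewrite big_ord1; apply: am.
move=> I a II [k kI] [l lI]; exists (k + l)%N => c cm.
rewrite big_split_ord /=.
have [i [r [iI ->]]] := kI (fun j => c (lshift l j)) (fun j => cm _).
rewrite mulrDl; apply: idealD => //; first by rewrite mulrC; apply: idealM.
rewrite -mulrA; apply: idealM => //; rewrite mulrC.
by apply: (lI (fun j => c (rshift k j))).
Qed.

Lemma ideal_pow_dvd (r : R) : r != 0 ->
  exists k, forall a, a \in ideal_pow m k -> exists b, a = b * r.
Proof.
move=> r0; have rI : ideal (fun a => exists b, a = b * r).
  split=> [|a _ _ [b ->] [c ->]]; first by exists 0; rewrite mul0r.
  by exists (a * b + c); ring.
have [|k kP] := ideal_contains_power rI _ r0; first by exists 1; rewrite mul1r.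
exists k => _ /asboolP[l [c [a [am ->]]]].
by apply: (ideal_sum rI) => i; exact: (@idealM _ _ (c i) _ rI (kP _ (am i))).
Qed.

(** In other words, $R/I$ is artinian. Only [m] and the unit ideal lie above [m]; in the dévissage
    step, the chain is stationary once $C_k + (a)$ and $(C_k : a)$ are. *)
Lemma ideal_descending_chain I x (C : nat -> R -> Prop) :
  ideal I -> I x -> x != 0 -> (forall k, ideal (C k)) ->
  (forall k y, I y -> C k y) -> (forall k y, C k.+1 y -> C k y) ->
  exists N, forall k y, (N <= k)%N -> C N y -> C k y.
Proof.
move=> II Ix x0; move: I x II Ix x0 C; apply: devissage.
- by move=> C _ CT _; exists 0%N => k y _ _; apply: CT.
- move=> C CI mC Cdec; have [[N CN]|nC] := pselect (exists N, ~ C N 1).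
    exists N => k y _ CNy; apply: mC.
    exact: (proper_sub_maximal hnoeth hlocal (CI N)).
  exists 0%N => k y _ _; rewrite -[y]mulr1; apply: idealM => //.
  by apply: contrapT => C1; apply: nC; exists k.
move=> I a II IHadd IHquo C CI IC Cdec.
have Cle k l y : (k <= l)%N -> C l y -> C k y.
  by move=> /subnKC <-; elim: (l - k)%N => [|j IHj]; rewrite ?addn0 ?addnS // => /Cdec.
have [|||N1 N1P] := IHadd (fun k => ideal_add (C k) a).
- by move=> k; apply: ideal_addP.
- by move=> k _ [i [r [iI ->]]]; exists i, r; split=> //; apply: IC.
- by move=> k _ [i [r [iI ->]]]; exists i, r; split=> //; apply: Cdec.
have [|||N2 N2P] := IHquo (fun k => ideal_quo (C k) a).
- by move=> k; apply: ideal_quoP.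
- by move=> k y yI; apply: IC.
- by move=> k y; apply: Cdec.
exists (N1 + N2)%N => k y le_k CNy.
(* Here $y = j + ra$ with [j] in [C k]. Then $ra = y - j$ lies in [C N2], so stability of the
   quotients puts it in [C k]. *)
have [|j [r [jC yE]]] := N1P k y (leq_trans (leq_addr _ _) le_k).
  by exists y, 0; rewrite mul0r addr0; split=> //; exact: (Cle _ _ _ (leq_addr _ _) CNy).
rewrite yE; apply: idealD => //.
apply: (N2P k r (leq_trans (leq_addl _ _) le_k)); rewrite /ideal_quo.
have -> : r * a = - 1 * j + y by rewrite yE; ring.
have [_ CN2] := CI N2; apply: CN2.
  exact: (Cle _ _ _ (leq_trans (leq_addl _ _) le_k) jC).
exact: (Cle _ _ _ (leq_addl _ _) CNy).
Qed.

End OneDimensional.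

(** * Completeness of torsion-free modules of finite rank *)

Lemma ideal_pow0 (R : comNzRingType) (I : {pred R}) a : a \in ideal_pow I 0.
Proof.
apply/asboolP; exists 1%N, (fun=> a), (fun _ _ => 0); split; first by move=> ? [].
by rewrite big_ord1 big_ord0 mulr1.
Qed.

Lemma ideal_powS (R : comNzRingType) (I : {pred R}) k x a :
  x \in I -> a \in ideal_pow I k -> x * a \in ideal_pow I k.+1.
Proof.
move=> xI /asboolP[l [c [b [bI ->]]]]; apply/asboolP.
exists l, c, (fun i j => if unlift ord0 j is Some j' then b i j' else x).
split=> [i j|]; first by case: (unlift _ _).
rewrite big_distrr /=; apply: eq_bigr => i _; rewrite big_ord_recl unlift_none.
by under [X in c i * (x * X)]eq_bigr do rewrite liftK; rewrite mulrCA.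
Qed.

Lemma ideal_pow_exp (R : comNzRingType) (I : {pred R}) k x a :
  x \in I -> x ^+ k * a \in ideal_pow I k.
Proof.
move=> xI; elim: k => [|k IHk]; first exact: ideal_pow0.
by rewrite exprS -mulrA; apply: ideal_powS.
Qed.

(** [y n] is the limit of the partial sums of $\sum_i x^i b_{n+i}$. As limits are unique, the
    recurrence of the partial sums passes to [y]. *)
Lemma adic_series (R : comNzRingType) (I : {pred R}) (x : R) (b : nat -> R) :
  adic_complete I -> x \in I -> exists y, forall k, y k = b k + x * y k.+1.
Proof.
move=> Ic xI; pose s n k := \sum_(i < k) x ^+ i * b (n + i)%N.
have /choice[y yP] : forall n, exists l, (forall k, l - s n k \in ideal_pow I k) /\
    forall l', (forall k, l' - s n k \in ideal_pow I k) -> l' = l.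
  move=> n; apply: Ic => k; rewrite /s big_ord_recr addrC addKr /=.
  exact: ideal_pow_exp.
exists y => n; apply/esym/(yP n).2 => -[|k]; first exact: ideal_pow0.
have -> : s n k.+1 = b n + x * s n.+1 k.
  rewrite /s big_ord_recl expr0 mul1r addn0 mulr_sumr; congr (_ + _).
  by apply: eq_bigr => i _; rewrite exprS mulrA addSnnS.
rewrite opprD addrACA subrr add0r -mulrBr; apply: ideal_powS => //.
exact: (yP n.+1).1.
Qed.

Local Notation "r %:F" := (FracField.tofrac r).

Lemma fractionP (R : idomainType) (q : {fraction R}) :
  exists a b : R, b != 0 /\ q = a%:F / b%:F.
Proof.
suff [y qE] : exists y : {ratio R}, q * (\d_y)%:F = (\n_y)%:F.
  exists \n_y, \d_y; split; first exact: denom_ratioP.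
  by rewrite -qE mulfK // tofrac_eq0 denom_ratioP.
elim/quotW: q => y; exists y; unlock FracField.tofrac.
rewrite -[LHS]FracField.pi_mul; apply/eqmodP => /=.
rewrite FracField.equivfE /= /FracField.mulf.
by rewrite !numden_Ratio ?mulr1 ?denom_ratioP ?oner_neq0 // mulrC.
Qed.

Section Completeness.
Variables (R : idomainType) (m : idealr R) (x : R).
Hypotheses (hnoeth : noetherian R) (hlocal : local_ring m) (hdim : krull_dim R 1).
Hypotheses (hcomplete : adic_complete m) (xm : x \in m) (x0 : x != 0).
Local Notation K := {fraction R}.

(** A predicate is used because [T] is a module over [K] only; [R] acts through [tofrac]. *)
Definition Rsubmod (T : lmodType K) (L : T -> Prop) :=
  L 0 /\ forall a u v, L u -> L v -> L (a%:F *: u + v).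

(* [b 0 + x b 1 + x^2 b 2 + ...] and its tails converge in [L], possibly to
   several limits. *)
Definition series_complete (T : lmodType K) (L : T -> Prop) :=
  forall b : nat -> T, (forall k, L (b k)) ->
  exists y, forall k, L (y k) /\ y k = b k + x%:F *: y k.+1.

Lemma RsubmodZ (T : lmodType K) (L : T -> Prop) a u :
  Rsubmod L -> L u -> L (a%:F *: u).
Proof. by move=> [L0 Lc] Lu; rewrite -[_ *: _]addr0; apply: Lc. Qed.

Lemma RsubmodD (T : lmodType K) (L : T -> Prop) u v :
  Rsubmod L -> L u -> L v -> L (u + v).
Proof.
by move=> [_ Lc] Lu Lv; rewrite -[u]scale1r -(rmorph1 (@FracField.tofrac R)); apply: Lc.
Qed.

Lemma RsubmodB (T : lmodType K) (L : T -> Prop) u v :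
  Rsubmod L -> L u -> L v -> L (u - v).
Proof.
by move=> [_ Lc] Lu Lv; rewrite addrC -scaleN1r -(rmorphN1 (@FracField.tofrac R)); apply: Lc.
Qed.

(** This is $Q = R[1/x]$, as $1/r = c/x^k$. *)
Lemma power_dvd (r : R) : r != 0 -> exists k c, x ^+ k = c * r.
Proof.
move=> r0; have [k kP] := ideal_pow_dvd hnoeth hlocal hdim r0; exists k.
by apply: kP; rewrite -[_ ^+ _]mulr1; apply: ideal_pow_exp.
Qed.

Lemma series_complete_line (T : lmodType K) (L : T -> Prop) (f : T) :
  Rsubmod L -> L f -> f != 0 ->
  (forall l, L l -> exists k r, (x ^+ k)%:F *: l = r%:F *: f) -> series_complete L.
Proof.
move=> LS Lf f0 Lf_tors; have L0 := LS.1.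
have xK : x%:F != 0 by rewrite tofrac_eq0.
(* The chain stops at [N]; hence [D = x^N L + R f] satisfies [D = x D + R f],
   so the sums can be corrected into the complete module [R f], and [D] is
   complete.  As [D <= L], solutions in [D] of equations with data in [x^N L]
   stay in [x^N L], which is isomorphic to [L]. *)
pose C k r := exists l s, L l /\ r%:F *: f = (x ^+ k.+1)%:F *: l + (x * s)%:F *: f.
have [|||||N NP] := @ideal_descending_chain _ m hnoeth hlocal hdim
    (fun r => exists s, r = x * s) x C _ _ x0.
- split=> [|a _ _ [s ->] [t ->]]; first by exists 0; rewrite mulr0.
  by exists (a * s + t); ring.
- by exists 1; rewrite mulr1.
- move=> k; split=> [|a u v [l [s [Ll uE]]] [l' [s' [Ll' vE]]]].
    by exists 0, 0; rewrite mulr0 tofrac0 !scale0r scaler0 addr0.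
  exists (a%:F *: l + l'), (a * s + s'); split; first exact: LS.2.
  have -> : (x * (a * s + s'))%:F = a%:F * (x * s)%:F + (x * s')%:F.
    by rewrite -rmorphM -rmorphD; congr (_ %:F); ring.
  rewrite rmorphD rmorphM !scalerDl -!scalerA uE vE !scalerDr addrACA.
  by congr (_ + _ + _); rewrite !scalerA mulrC.
- by move=> k _ [s ->]; exists 0, s; rewrite scaler0 add0r.
- move=> k r [l [s [Ll rE]]]; exists (x%:F *: l), s; split; first exact: RsubmodZ.
  by rewrite rE scalerA -rmorphM -exprSr.
pose D u := exists l s, L l /\ u = (x ^+ N)%:F *: l + s%:F *: f.
have DS u l s : D u -> L l ->
    D (u - ((x ^+ N)%:F *: l + s%:F *: f)).
  move=> [l' [s' [Ll' ->]]] Ll; exists (l' - l), (s' - s).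
  by split; [apply: RsubmodB | rewrite opprD addrACA scalerBr rmorphB scalerBl].
have DL u : D u -> L u.
  by move=> [l [s [Ll ->]]]; apply: RsubmodD => //; apply: RsubmodZ.
(* Induction on the exponent [j] that brings [u] into $Rf$. The coefficient [r] lies in [C N], hence
   far down the chain; subtracting $x^{N+1} l'$ from [u] then lets one factor [x] cancel. *)
have Dx j u : D u -> (exists r, (x ^+ j)%:F *: u = r%:F *: f) ->
    exists l s, L l /\ u = (x ^+ N.+1)%:F *: l + s%:F *: f.
  elim: j u => [|j IHj] u Du [r rE].
    by exists 0, r; split=> //; rewrite scaler0 add0r -rE expr0 tofrac1 scale1r.
  have [l [s [Ll uE]]] := Du.
  have CNr : C N r.
    exists ((x ^+ j)%:F *: l), (x ^+ j * s); split; first exact: RsubmodZ.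
    rewrite -rE uE scalerDr !scalerA -!rmorphM.
    by congr (_ %:F *: _ + _ %:F *: _); rewrite !exprS; ring.
  have [l' [s' [Ll' rE']]] := NP (N + j).+1 r (leqW (leq_addr _ _)) CNr.
  have [||l2 [s2 [Ll2 u2E]]] := IHj (u - (x ^+ N.+1)%:F *: l').
  - have := DS u (x%:F *: l') 0 Du (RsubmodZ _ LS Ll').
    by rewrite tofrac0 scale0r addr0 scalerA -rmorphM -exprSr.
  - exists s'; apply: (scalerI xK); rewrite !scalerBr !scalerA -!rmorphM -exprS rE rE'.
    have -> : x ^+ j.+1 * x ^+ N.+1 = x ^+ (N + j).+2 by rewrite !exprS exprD; ring.
    by rewrite addrAC subrr add0r.
  exists (l2 + l'), s2; split; first exact: RsubmodD.
  by rewrite scalerDr addrAC -u2E subrK.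
(* The default [(0, 0)] outside [D] makes the division by [x] total, so that choice applies. *)
have Dstep u : exists vr : T * R, D u -> D vr.1 /\ u = x%:F *: vr.1 + vr.2%:F *: f.
  have [Du|nDu] := pselect (D u); last by exists (0, 0).
  have [k ku] := Lf_tors u (DL u Du); have [l [s [Ll uE]]] := Dx k u Du ku.
  exists ((x ^+ N)%:F *: l, s) => _; split; last by rewrite uE scalerA -rmorphM -exprS.
  by exists l, 0; rewrite tofrac0 scale0r addr0.
have [g gP] := choice Dstep.
have Dc : series_complete D.
  (* Dividing [z k - b k] by [x] gives [z k.+1] and a remainder [h k] times [f]. The series [w] with
     terms [- h k], summed in [R], cancels these remainders. *)
  move=> b Db; pose z := fix z k := if k is k'.+1 then (g (z k' - b k')).1 else 0.
  have DB u v : D u -> D v -> D (u - v).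
    by move=> Du [l [s [Ll ->]]]; apply: DS.
  have Dz k : D (z k).
    elim: k => [|k Dk] /=; first by exists 0, 0; rewrite tofrac0 scale0r scaler0 addr0.
    by have [] := gP _ (DB _ _ Dk (Db k)).
  pose h k := (g (z k - b k)).2.
  have zE k : z k = b k + x%:F *: z k.+1 + (h k)%:F *: f.
    have [_ e] := gP _ (DB _ _ (Dz k) (Db k)).
    by rewrite -addrA -[X in _ + X]e addrC subrK.
  have [w wP] := adic_series (fun k => - h k) hcomplete xm.
  exists (fun k => z k + (w k)%:F *: f) => k; split.
    have := DS _ 0 (- w k) (Dz k) L0.
    by rewrite scaler0 add0r rmorphN scaleNr opprK.
  rewrite {1}zE {1}wP rmorphD rmorphN rmorphM scalerDl scaleNr scalerDr scalerA.
  by rewrite -!addrA; congr (_ + (_ + _)); rewrite addrA subrr add0r.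
move=> b Lb; have [|y yP] := Dc (fun k => (x ^+ N)%:F *: b k).
  by move=> k; exists (b k), 0; rewrite tofrac0 scale0r addr0.
(* Unrolling the recurrence [i] times; for [i = N] both terms lie in $x^N L$. *)
have yN i k : exists2 l, L l & y k = (x ^+ N)%:F *: l + (x ^+ i)%:F *: y (i + k)%N.
  elim: i k => [|i IHi] k.
    by exists 0 => //; rewrite scaler0 add0r expr0 tofrac1 scale1r.
  have [l Ll ->] := IHi k; have [_ ->] := yP (i + k)%N.
  exists (l + (x ^+ i)%:F *: b (i + k)%N).
    by apply: RsubmodD => //; apply: RsubmodZ.
  by rewrite exprSr rmorphM !scalerDr !scalerA [_ * (x ^+ N)%:F]mulrC addrA.
have /choice[w wP] k : exists w, L w /\ y k = (x ^+ N)%:F *: w.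
  have [l Ll ->] := yN N k; exists (l + y (N + k)%N).
  by rewrite scalerDr; split=> //; apply: RsubmodD => //; apply/DL/(yP _).1.
exists w => k; split; first exact: (wP k).1.
apply: (@scalerI _ _ (x ^+ N)%:F); first by rewrite tofrac_eq0 expf_neq0.
rewrite -(wP k).2 (yP k).2 scalerDr (wP k.+1).2 !scalerA; congr (_ + _ *: _).
exact: mulrC.
Qed.

(** Finite dimension enters through finitely many functionals separating the points of [L], so [T]
    stays fixed in the induction. [L] is an extension of its image in [K] under [l], a line, by
    [L1], where [l] vanishes; completeness of both yields that of [L]. *)
Lemma series_complete_functionals (T : lmodType K) (I : eqType)
    (F : I -> {linear T -> K^o}) (s : seq I) (L : T -> Prop) : Rsubmod L ->
  (forall t, L t -> (forall i, i \in s -> F i t = 0) -> t = 0) ->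
  series_complete L.
Proof.
elim: s L => [|i s IHs] L LS Ls.
  move=> b Lb; exists (fun=> 0) => k; split; first exact: LS.1.
  by rewrite scaler0 addr0 (Ls (b k)).
set l := F i in Ls *; have [] := pselect (forall t, L t -> l t = 0).
  move=> l0; apply: IHs => // t Lt ts; apply: Ls => // i'; rewrite inE.
  by case/predU1P=> [->|/ts//]; apply: l0.
move=> /existsNP[e] /not_implyP[Le /eqP le0].
pose L1 t := L t /\ l t = 0.
have L1c : series_complete L1.
  apply: IHs => [|t [Lt lt0] ts].
    split=> [|a u v [Lu lu] [Lv lv]]; first by split; [apply: LS.1 | apply: linear0].
    by split; [apply: LS.2 | rewrite linearP lu lv scaler0 addr0].
  by apply: Ls => // i'; rewrite inE; case/predU1P=> [->|/ts].
pose LK (q : K^o) := exists2 t, L t & l t = q.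
have LKS : Rsubmod LK.
  split=> [|a _ _ [u Lu <-] [v Lv <-]]; first by exists 0; [apply: LS.1 | apply: linear0].
  by exists (a%:F *: u + v); [apply: LS.2 | rewrite linearP].
have LKc : series_complete LK.
  apply: (series_complete_line LKS _ le0); first by exists e.
  move=> q _; have [a [c [c0 qE]]] := fractionP (q / l e).
  have [k [d xE]] := power_dvd c0; exists k, (d * a).
  have -> : q = (q / l e) *: l e by rewrite -[RHS]/(q / l e * l e) divfK.
  rewrite qE scalerA xE !rmorphM; congr (_ *: _).
  by rewrite -mulrA [c%:F * _]mulrCA divff ?tofrac_eq0 // mulr1.
move=> b Lb; have [|y yP] := LKc (fun k => l (b k)); first by move=> k; exists (b k).
have /choice[z zP] k : exists z, L z /\ l z = y k.
  by have [[z Lz zE] _] := yP k; exists z.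
(* The lifts [z] of the sums [y] satisfy the recurrence only up to a defect in [L1]; this defect is
   summed there. *)
have [|w wP] := L1c (fun k => b k - z k + x%:F *: z k.+1).
  move=> k; split.
    rewrite addrC; apply: LS.2; first exact: (zP _).1.
    by apply: RsubmodB => //; apply: (zP _).1.
  rewrite linearD linearB linearZ !(zP _).2 {1}(yP k).2 /=.
  by rewrite opprD addrA subrr sub0r addNr.
exists (fun k => w k + z k) => k; split.
  by apply: RsubmodD => //; [apply: (wP k).1.1 | apply: (zP k).1].
rewrite {1}(wP k).2 scalerDr -!addrA; congr (_ + _).
by rewrite addrC -!addrA subrr addr0 addrC.
Qed.

End Completeness.

(** * Lifting isomorphisms of quotients *)

Lemma bij_of_inj_surj (T U : Type) (f : T -> U) :
  injective f -> (forall u, exists t, f t = u) -> bijective f.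
Proof. by move=> fI /choice[g gK]; exists g => // t; apply: fI; rewrite gK. Qed.

(** * Linear relations between spaces of equal dimension *)

Section LinearRelation.
Variables (K : fieldType) (T T' : vectType K) (S : T -> T' -> Prop).
Hypothesis S0 : S 0 0.
Hypothesis Slin : forall a t t' u u', S t t' -> S u u' -> S (a *: t + u) (a *: t' + u').
Hypothesis Stotal : forall t, exists t', S t t'.
Hypothesis Ssurj : forall t', exists t, S t t'.
Hypothesis dimE : \dim {:T} = \dim {:T'}.

Let linear_graph (f : 'Hom(T, T')) := forall t, S t (f t).

(** Choose partners for the basis vectors and extend linearly. *)
Lemma exists_linear_graph : exists f, linear_graph f.
Proof.
have [s sP] := choice Stotal.
pose f t := \sum_i coord (vbasis {:T}) i t *: s (vbasis {:T})`_i.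
have fL : linear f.
  move=> a t u; rewrite /f scaler_sumr -big_split; apply: eq_bigr => i _.
  by rewrite linearP /= scalerDl scalerA.
pose fl : {linear T -> T'} := HB.pack f (GRing.isLinear.Build K T T' *:%R f fL).
exists (linfun fl) => t; rewrite lfunE /= {1}[t](coord_vbasis (memvf t)) /f.
elim/big_rec2: _ => // i u' u _ uu'; exact: Slin.
Qed.

(* If [f] is not injective, it is not onto either, so [S 0 d] for some [d] outside
   its image; adding [d] times a coordinate that does not vanish on the kernel
   of [f] shrinks the kernel. *)
Lemma improve_linear_graph (f : 'Hom(T, T')) : linear_graph f -> lker f != 0%VS ->
  exists2 g, linear_graph g & (\dim (lker g) < \dim (lker f))%N.
Proof.
move=> fS kf0; have [k kf k0] : exists2 k, k \in lker f & k != 0.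
  by exists (vpick (lker f)); rewrite ?memv_pick ?vpick0.
have [d Sd df] : exists2 d, S 0 d & d \notin limg f.
  apply: contrapT => noD; case/negP: kf0; rewrite -dimv_eq0.
  have := limg_ker_dim f fullv; rewrite capfv dimE.
  suff -> : limg f = fullv by move=> /(canRL (addnK _)) ->; rewrite subnn.
  apply/eqP; rewrite eqEsubv subvf; apply/subvP => t' _.
  have [t St] := Ssurj t'; rewrite -[t'](subrK (f t)) memvD ?memv_img ?memvf //.
  apply/negPn/negP => h; apply: noD; exists (t' - f t) => //.
  by have := Slin (-1) (fS t) St; rewrite !scaleN1r addNr addrC.
have [i ki] : exists i, coord (vbasis {:T}) i k != 0.
  apply: contrapT => h; case/eqP: k0; rewrite [k](coord_vbasis (memvf k)).
  rewrite big1 // => i _; have [->|ki] := eqVneq (coord (vbasis {:T}) i k) 0.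
    by rewrite scale0r.
  by case: h; exists i.
pose g0 t := f t + coord (vbasis {:T}) i t *: d.
have gL : linear g0.
  by move=> a t u; rewrite /g0 !linearP /= scalerDl scalerDr scalerA addrACA.
pose gl : {linear T -> T'} := HB.pack g0 (GRing.isLinear.Build K T T' *:%R g0 gL).
exists (linfun gl) => [t|].
  have := Slin (coord (vbasis {:T}) i t) Sd (fS t).
  by rewrite scaler0 add0r lfunE /= /g0 addrC.
have gker t : t \in lker (linfun gl) -> coord (vbasis {:T}) i t = 0.
  rewrite memv_ker lfunE /= /g0 => e; apply: contrapT => /eqP ti0.
  case/negP: df; rewrite -[d](scalerK ti0) memvZ //.
  by move: e; rewrite addrC addr_eq0 => /eqP->; rewrite rpredN memv_img ?memvf.
have sub : (lker (linfun gl) <= lker f)%VS.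
  apply/subvP => t tg; have := tg; rewrite !memv_ker lfunE /= /g0 gker //.
  by rewrite scale0r addr0.
rewrite ltn_neqAle dimvS // andbT; apply: contraNneq ki => e.
have /eqP gf : lker (linfun gl) == lker f by rewrite eqEdim sub e leqnn.
by rewrite gker // gf.
Qed.

Lemma exists_bijective_graph : exists f : 'Hom(T, T'), linear_graph f /\ bijective f.
Proof.
have [f0 f0S] := exists_linear_graph.
have [f fS fk] : exists2 f, linear_graph f & lker f = 0%VS.
  have [n] := ubnP (\dim (lker f0)); elim: n f0 f0S => // n IHn f fS kf.
  have [k0|kn0] := eqVneq (lker f) 0%VS; first by exists f.
  have [g gS kg] := improve_linear_graph fS kn0.
  exact: (IHn g gS (leq_trans kg kf)).
exists f; split=> //; have fI : injective f by apply/lker0P/eqP.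
apply: bij_of_inj_surj => // t'.
suff /memv_imgP[t _ ->] : t' \in limg f by exists t.
suff -> : limg f = fullv by apply: memvf.
apply/eqP; rewrite eqEdim subvf -dimE limg_dim_eq; first by rewrite leqnn.
by rewrite fk capv0.
Qed.

End LinearRelation.

(* [j : B -> T] and [p : T -> H] present [H] as the quotient of the [Q]-space
   [T] by its [R]-submodule [B]. *)
Definition presents (R : idomainType) (B H : lmodType R) (T : vectType {fraction R})
    (j : B -> T) (p : T -> H) :=
  [/\ forall r b c, j (r *: b + c) = r%:F *: j b + j c,
      injective j,
      forall r t u, p (r%:F *: t + u) = r *: p t + p u,
      forall h, exists t, p t = h
    & forall t, p t = 0 <-> exists b, t = j b].

(** * Lifting along a presentation *)

Section Presentations.
Variables (R : idomainType) (m : idealr R).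
Hypotheses (hnoeth : noetherian R) (hlocal : local_ring m) (hdim : krull_dim R 1).
Hypothesis hcomplete : adic_complete m.
Local Notation K := {fraction R}.

Section OnePresentation.
Variables (B H : lmodType R) (T : vectType K) (j : B -> T) (p : T -> H).
Hypothesis pres : presents j p.

Lemma pres0 : p 0 = 0.
Proof.
have [_ _ pl _ _] := pres; have := pl (-1) 0 0.
by rewrite scaler0 addr0 scaleN1r addNr.
Qed.

Lemma presZ r t : p (r%:F *: t) = r *: p t.
Proof. by have [_ _ pl _ _] := pres; rewrite -[_ *: t]addr0 pl pres0 addr0. Qed.

Lemma presD t u : p (t + u) = p t + p u.
Proof.
by have [_ _ pl _ _] := pres; rewrite -[t]scale1r -(rmorph1 (@FracField.tofrac R)) pl
  rmorph1 !scale1r.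
Qed.

Lemma presB t u : p (t - u) = p t - p u.
Proof.
rewrite presD; congr (_ + _).
by rewrite -!scaleN1r -(rmorphN1 (@FracField.tofrac R)) presZ.
Qed.

(** The coordinates in a basis of [T] separate points. *)
Lemma pres_kernel_complete x : x \in m -> x != 0 ->
  @series_complete R x T (fun t => p t = 0).
Proof.
move=> xm x0; pose F i : {linear T -> K^o} := coord (vbasis {:T}) i.
apply: (series_complete_functionals hnoeth hlocal hdim hcomplete xm x0
  (F := F) (s := enum 'I_(\dim {:T}))).
  split=> [|a u v pu pv]; first exact: pres0.
  by have [_ _ pl _ _] := pres; rewrite pl pu pv scaler0 addr0.
move=> t _ ts; rewrite [t](coord_vbasis (memvf t)) big1 // => i _.
by have := ts i (mem_enum _ _); rewrite /F /= => ->; rewrite scale0r.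
Qed.

(** The map is lifted on one [Q]-line at a time. Lifts [u k] of $f(x^{-k} v)$ are compatible only
    modulo the kernel of [p]; completeness supplies corrections [y k] in that kernel with $x w_{k+1}
    = w_k$ for $w = u + y$. Then [t = w 0] works on $R[1/x] = Q$. *)
Lemma pres_lift (V : lmodType K) (f : V -> H) (v : V) :
  (forall r u w, f (r%:F *: u + w) = r *: f u + f w) ->
  exists t, forall q : K, f (q *: v) = p (q *: t).
Proof.
move=> fl; have f0 : f 0 = 0.
  by have := fl (-1) 0 0; rewrite scaler0 addr0 scaleN1r addNr.
have fZ r u : f (r%:F *: u) = r *: f u by rewrite -[_ *: u]addr0 fl f0 addr0.
have [x xm x0] := exists_maximal_nonzero hnoeth hlocal hdim.
have xF k : (x ^+ k)%:F != 0 by rewrite tofrac_eq0 expf_neq0.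
have [_ _ _ psurj _] := pres.
have /choice[u uP] k := psurj (f ((x ^+ k)%:F^-1 *: v)).
have [|y yP] := pres_kernel_complete xm x0 (b := fun k => x%:F *: u k.+1 - u k).
  move=> k; rewrite presB presZ !uP -fZ scalerA exprS rmorphM invfM mulrA.
  by rewrite divff ?tofrac_eq0 // mul1r subrr.
pose w k := u k + y k.
have wS k : x%:F *: w k.+1 = w k.
  by rewrite /w (yP k).2 addrA [u k + _]addrC subrK scalerDr.
have wX k : (x ^+ k)%:F *: w k = w 0.
  elim: k => [|k IHk]; first by rewrite expr0 tofrac1 scale1r.
  by rewrite exprSr rmorphM -scalerA wS.
exists (w 0) => q; have [a [c [c0 ->]]] := fractionP q.
have [k [d xE]] := power_dvd hnoeth hlocal hdim xm c0.
have -> : a%:F / c%:F = (a * d)%:F * (x ^+ k)%:F^-1.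
  have d0 : d != 0.
    by have := xF k; rewrite tofrac_eq0 xE mulf_eq0 negb_or => /andP[].
  rewrite xE !rmorphM invfM -!mulrA; congr (_ * _).
  by rewrite mulrA divff ?tofrac_eq0 // mul1r.
rewrite -!scalerA fZ presZ; congr (_ *: _).
by rewrite -(wX k) scalerK // /w presD (yP k).1 addr0 uP.
Qed.

End OnePresentation.

Lemma presents_iso (B H B' H' : lmodType R) (T T' : vectType K)
    (j : B -> T) (p : T -> H) (j' : B' -> T') (p' : T' -> H') :
  presents j p -> presents j' p' -> lmod_iso H H' ->
  \dim {:T} = \dim {:T'} -> lmod_iso B B'.
Proof.
move=> P P' [phi [psi phiK psiK]] dimE.
(* Quantifying over [q] makes the relation [K]-linear; at [q = 1] it says that [t] and [t'] have
   corresponding classes, so a bijection in [S] matches the kernels of [p] and [p']. *)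
pose S t t' := forall q : K, phi (p (q *: t)) = p' (q *: t').
have [||||Psi [PsiS PsiB]] := @exists_bijective_graph K T T' S _ _ _ _ dimE.
- by move=> q; rewrite !scaler0 (pres0 P) (pres0 P') linear0.
- move=> a t t' u u' tt' uu' q.
  by rewrite !scalerDr !scalerA (presD P) (presD P') linearD tt' uu'.
- move=> t; apply: (pres_lift P' t (f := phi \o p)) => r u w /=.
  by rewrite (presD P) (presZ P) linearP.
- move=> t'; have [r u w|t tP] := pres_lift P t' (f := psi \o p').
    by apply: (can_inj phiK); rewrite /= linearP !psiK (presD P') (presZ P').
  by exists t => q; rewrite -tP /= psiK.
have [jl jI _ _ kerp] := P; have [jl' jI' _ _ kerp'] := P'.
have Psip t : p' (Psi t) = phi (p t) by have := PsiS t 1; rewrite !scale1r.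
have /choice[F FP] b : exists b', Psi (j b) = j' b'.
  by apply/kerp'; rewrite Psip (kerp _).2 ?linear0 //; exists b.
have Fl : linear F.
  by move=> a b c; apply: jI'; rewrite jl' -!FP jl linearP.
pose FL : {linear B -> B'} := HB.pack F (GRing.isLinear.Build R B B' *:%R F Fl).
exists FL; apply: bij_of_inj_surj => [b c /= e|b'].
  by apply: jI; apply: (bij_inj PsiB); rewrite !FP e.
have [Psi' Psi'K PsiK] := PsiB.
have /kerp[b bE] : p (Psi' (j' b')) = 0.
  by apply: (can_inj phiK); rewrite linear0 -Psip PsiK; apply/kerp'; exists b'.
by exists b; apply: jI'; rewrite -FP -bE PsiK.
Qed.

End Presentations.

(** * First local cohomology as a quotient *)

(** The summand $Q^k$ goes to 0 in [H], so the dimension grows while the presented module stays the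
    same. *)
Lemma presents_sum_frac (R : idomainType) (B H : lmodType R) (T : vectType {fraction R})
    (j : B -> T) (p : T -> H) (k : nat) :
  presents j p ->
  exists (T1 : vectType {fraction R})
    (j1 : (B * {ffun 'I_k -> frac_mod R})%type -> T1) (p1 : T1 -> H),
    presents j1 p1 /\ \dim {:T1} = (\dim {:T} + k)%N.
Proof.
move=> [jl jI pl psurj kerp].
exists (T * {ffun 'I_k -> {fraction R}^o})%type, (fun u => (j u.1, u.2)), (fun u => p u.1).
split; last first.
  rewrite !dimvf -[LHS]/(dim T + #|'I_k| * 1)%N.
  by rewrite card_ord muln1.
split=> /=.
- move=> r [b f] [c g] /=; congr (_, _); first exact: jl.
- by move=> [b f] [c g] /= [/jI-> ->].
- by move=> r [t f] [u g]; apply: pl.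
- by move=> h; have [t <-] := psurj h; exists (t, 0).
move=> [t f] /=; split=> [/kerp[b ->]|[[b g] /= [-> _]]]; first by exists (b, f).
by apply/kerp; exists b.
Qed.

(** A subspace inside [P] is enlarged by one vector at a time; its codimension bounds the number of
    steps. *)
Lemma subspace_vspace (K : fieldType) (T : vectType K) (P : T -> Prop) :
  P 0 -> (forall a t u, P t -> P u -> P (a *: t + u)) ->
  exists U : {vspace T}, forall t, t \in U <-> P t.
Proof.
move=> P0 Pl; suff [U [UP PU]] : exists U : {vspace T},
    (forall t, t \in U -> P t) /\ forall t, P t -> t \in U.
  by exists U => t; split; [apply: UP | apply: PU].
have zP t : t \in (0%VS : {vspace T}) -> P t by rewrite memv0 => /eqP->.
have [n] := ubnP (\dim {:T} - \dim (0%VS : {vspace T}))%N.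
elim: n 0%VS zP => // n IHn U UP Un.
have [PU|] := pselect (forall t, P t -> t \in U); first by exists U.
move=> /existsNP[t] /not_implyP[Pt /negP tU].
apply: (IHn (U + <[t]>)%VS).
  move=> _ /memv_addP[u uU [_ /vlineP[a ->] ->]].
  by rewrite addrC; apply: Pl => //; apply: UP.
have ltU : (\dim U < \dim (U + <[t]>))%N.
  rewrite ltn_neqAle dimvS ?addvSl // andbT; apply: contra tU => e.
  have /eqP -> : U == (U + <[t]>)%VS by rewrite eqEdim addvSl -(eqP e) leqnn.
  exact: (subvP (addvSr _ _)) (memv_line t).
rewrite ltnS in Un; apply: leq_trans Un; apply: ltn_sub2l => //.
by apply: leq_trans ltU _; apply: dimvS; apply: subvf.
Qed.

(** Extend $s \mapsto s e$ along multiplication by [r] on [R], and evaluate at 1. *)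
Lemma injective_divisible (R : idomainType) (E : lmodType R) (r : R) (e : E) :
  injective_module E -> r != 0 -> exists e', r *: e' = e.
Proof.
move=> Einj r0.
have il : linear (fun s : R^o => r * s : R^o).
  by move=> a u v; rewrite mulrDr [in RHS]/GRing.scale /= mulrCA.
have fl : linear (fun s : R^o => s *: e).
  by move=> a u v; rewrite scalerDl -scalerA.
pose i : {linear R^o -> R^o} := HB.pack (fun s : R^o => r * s : R^o)
  (GRing.isLinear.Build R R^o R^o *:%R _ il).
pose f : {linear R^o -> E} := HB.pack (fun s : R^o => s *: e)
  (GRing.isLinear.Build R R^o E *:%R _ fl).
have [g gE] := Einj _ _ i f (mulfI r0).
exists (g 1); rewrite -linearZ /=; have := gE 1; rewrite /= scale1r => <-.
by congr (g _); rewrite mulr1 [LHS]mulr1.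
Qed.

Lemma quot_projP (R : pzRingType) (M : lmodType R) (S : submodClosed M) :
  linear (@quot_proj R M S).
Proof. by move=> a x y; rewrite quot_projD -quot_scale_proj. Qed.

HB.instance Definition _ (R : pzRingType) (M : lmodType R) (S : submodClosed M) :=
  GRing.isLinear.Build R M (quot_mod S) *:%R (@quot_proj R M S) (@quot_projP R M S).

Lemma quot_proj_eq0 (R : pzRingType) (M : lmodType R) (S : submodClosed M) (x : M) :
  quot_proj S x = 0 <-> x \in S.
Proof.
have e : (x \in S) = (quot_proj S x == quot_proj S 0).
  by have := Quotient.idealrBE (submod_pred S) x 0; rewrite subr0.
by rewrite e linear0; split=> [->|/eqP].
Qed.

(** * Embedding a torsion-free module into its tensor product with the fraction field *)

Section TensorHull.
Variables (R : idomainType) (B : lmodType R) (E : lmodType R) (aug : {linear B -> E}).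
Hypotheses (hB : torsion_free B) (Einj : injective_module E) (aug_inj : injective aug).
Local Notation K := {fraction R}.

(** As [E] is divisible, its quotient by torsion is a [Q]-space; it serves as the target of a
    balanced map on $B \times Q$. *)
Definition torsion_pred : {pred E} := fun e => `[< exists2 r : R, r != 0 & r *: e = 0 >].

Fact torsion_submod_closed : submod_closed torsion_pred.
Proof.
split; first by apply/asboolP; exists 1; rewrite ?oner_neq0 ?scaler0.
move=> a x y /asboolP[r r0 rx] /asboolP[s s0 sy]; apply/asboolP.
exists (r * s); first by rewrite mulf_neq0.
rewrite scalerDr scalerA; have -> : r * s * a = s * a * r by ring.
by rewrite -!scalerA rx sy !scaler0 addr0.
Qed.

HB.instance Definition _ :=
  GRing.isSubmodClosed.Build R E torsion_pred torsion_submod_closed.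

(* [v] is the value of [b * q] in [E] modulo torsion, which contains the
   localization of [B]. *)
Let scaled (b : B) (q : K) (v : quot_mod torsion_pred) :=
  exists a s e, [/\ s != 0, q * s%:F = a%:F, s *: e = a *: aug b & v = quot_proj _ e].

Let scaled_total b q : exists v, scaled b q v.
Proof.
have [a [s [s0 ->]]] := fractionP q.
have [e eE] := injective_divisible (a *: aug b) Einj s0.
by exists (quot_proj _ e), a, s, e; split=> //; rewrite divfK ?tofrac_eq0.
Qed.

Let cross (q : K) a s a' s' :
  q * s%:F = a%:F -> q * s'%:F = a'%:F -> a * s' = a' * s.
Proof. by move=> qs qs'; apply/eqP; rewrite -tofrac_eq !tofracM -qs -qs' mulrAC. Qed.

Let scaled_uniq b q v v' : scaled b q v -> scaled b q v' -> v = v'.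
Proof.
move=> [a [s [e [s0 qs se ->]]]] [a' [s' [e' [s'0 qs' se' ->]]]].
apply/eqP; rewrite -subr_eq0 -linearB; apply/eqP/quot_proj_eq0/asboolP.
exists (s * s'); first by rewrite mulf_neq0.
have as' := cross qs qs'.
rewrite scalerBr {1}[s * s']mulrC -!scalerA se se' !scalerA [s' * a]mulrC as'.
by rewrite mulrC subrr.
Qed.

(** The assignment [scaled] is balanced, so it factors through [T] and sends [t b 1] to the class of
    [aug b]. If [t b 1] is 0, then [aug b] is torsion, and [b] vanishes since [B] is
    torsion-free. *)
Lemma tensor_unit_injective (T : zmodType) (t : B -> frac_mod R -> T) (b : B) :
  is_tensor t -> t b (1 : K) = 0 -> b = 0.
Proof.
move=> [tbal tuniv] tb0.
have [f fP] := choice (fun bq : B * K => scaled_total bq.1 bq.2).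
have [|g [gE _]] := tuniv _ (fun b q => f (b, q)).
  split=> [c c' q|c q q'|r c q].
  - apply: (scaled_uniq (fP (_, _))) => /=.
    have [a [s [e [s0 qs se ->]]]] := fP (c, q).
    have [a' [s' [e' [s'0 qs' se' ->]]]] := fP (c', q).
    exists (a * s'), (s * s'), (e + e'); rewrite mulf_neq0 //; split=> //.
    + by rewrite !tofracM -qs mulrA.
    + have as' := cross qs qs'.
      rewrite [aug _]linearD !scalerDr {1}[s * s']mulrC -!scalerA se se' !scalerA.
      by rewrite [s' * a]mulrC [s * a']mulrC as'.
    + by rewrite linearD.
  - apply: (scaled_uniq (fP (_, _))) => /=.
    have [a [s [e [s0 qs se ->]]]] := fP (c, q).
    have [a' [s' [e' [s'0 qs' se' ->]]]] := fP (c, q').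
    exists (a * s' + a' * s), (s * s'), (e + e'); rewrite mulf_neq0 //; split=> //.
    + by rewrite tofracD !tofracM -qs -qs' /= mulrDl; congr (_ + _); ring.
    + rewrite scalerDr scalerDl {1}[s * s']mulrC -!scalerA se se' !scalerA.
      by rewrite [s' * a]mulrC [s * a']mulrC.
    + by rewrite linearD.
  apply/esym/(scaled_uniq (fP (_, _))) => /=.
  have [a [s [e [s0 qs se ->]]]] := fP (r *: c, q).
  exists (a * r), s, e; split=> //.
    by rewrite -[r *: q]/(r%:F * q) -mulrA qs -rmorphM mulrC.
  by rewrite se linearZ scalerA.
have /quot_proj_eq0/asboolP[r r0] : quot_proj torsion_pred (aug b) = 0.
  have := gE b 1; rewrite tb0 raddf0 => ->; apply/esym/(scaled_uniq (fP (_, _))).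
  by exists 1, 1, (aug b); rewrite oner_neq0 mulr1 scale1r.
by rewrite -linearZ -(linear0 aug) => /aug_inj/hB[/eqP|//]; rewrite (negPf r0).
Qed.

End TensorHull.

(** Common denominators make the set [P] of such [u] a subspace, and it contains all pure tensors.
    The identity and the projection onto it agree on these, so they coincide by the universal
    property. *)
Lemma tensor_spanned (R : idomainType) (B : lmodType R) (T : vectType {fraction R})
    (t : B -> frac_mod R -> T) :
  is_tensor t -> (forall (b : B) (p q : {fraction R}), t b (p * q) = p *: t b q) ->
  forall u, exists (r : R) b, r != 0 /\ r%:F *: u = t b (1 : {fraction R}).
Proof.
move=> [tbal tuniv] tZ.
have [tD _ tZl] := tbal.
have tR r b q : t (r *: b) q = r%:F *: t b q by rewrite tZl -tZ.
pose P u := exists (r : R) b, r != 0 /\ r%:F *: u = t b (1 : {fraction R}).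
have [||U UP] := @subspace_vspace _ T P.
- exists 1, 0; rewrite oner_neq0 scaler0; split=> //.
  by rewrite -(scale0r (0 : B)) tR tofrac0 scale0r.
- move=> q u v [r [b [r0 ru]]] [s [c [s0 sv]]].
  have [a [d [d0 ->]]] := fractionP q.
  exists (r * s * d), ((a * s) *: b + (r * d) *: c); split; first by rewrite !mulf_neq0.
  rewrite tD !tR -ru -sv scalerDr !scalerA; congr (_ *: _ + _ *: _).
    by rewrite !tofracM mulrACA divff ?tofrac_eq0 // mulr1; ring.
  by rewrite !tofracM; ring.
have tU b q : t b q \in U.
  apply/UP; have [a [d [d0 ->]]] := fractionP q; exists d, (a *: b); split=> //.
  by rewrite tR -!tZ mulr1 mulrCA divff ?tofrac_eq0 // mulr1.
have [g [gE guniq]] := tuniv _ t tbal.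
move=> u; apply/UP; rewrite -[u](_ : idfun u = u) // (guniq idfun) //.
rewrite -(guniq (projv U)) ?memv_proj // => b q.
by rewrite /= projv_id.
Qed.

Lemma submod_valP (R : pzRingType) (M : lmodType R) (S : submodClosed M) a
  (u v : submod_of S) : val (a *: u + v) = a *: val u + val v.
Proof. by []. Qed.

(** * Presenting the first local cohomology *)

Section LocalCohomology.
Variables (R : idomainType) (m : idealr R).
Hypotheses (hnoeth : noetherian R) (hlocal : local_ring m) (hdim : krull_dim R 1).
Variables (B : lmodType R) (E : inj_resolution B).
Hypothesis hB : torsion_free B.
Local Notation K := {fraction R}.
Local Notation aug := (res_aug E).
Local Notation d0 := (res_diff E 0).
Local Notation dGamma := (fun k => Gamma_map m (res_diff E k) : {linear _ -> _}).

(** Every nonzero [r] divides all elements of some power of [m], so $\Gamma_m$ is the full torsion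
    submodule. *)
Lemma gamma_torsion (M : lmodType R) (z : M) :
  z \in @gamma_pred R m M <-> exists2 r : R, r != 0 & r *: z = 0.
Proof.
split=> [/asboolP[k kz]|[r r0 rz]].
  have [x xm x0] := exists_maximal_nonzero hnoeth hlocal hdim.
  exists (x ^+ k); first by rewrite expf_neq0.
  by apply: kz; rewrite -[_ ^+ _]mulr1; apply: ideal_pow_exp.
have [k kP] := ideal_pow_dvd hnoeth hlocal hdim r0.
by apply/asboolP; exists k => a /kP[b ->]; rewrite -scalerA rz scaler0.
Qed.

(* The class of [d0 e]; every class arises this way, as [E] is exact. *)
Definition class_of (e : res_obj E 0) (h : local_cohomology m E 1) :=
  exists2 y : cocycles dGamma 1,
    val (val y) = d0 e & h = quot_proj (@coboundary R _ dGamma 1) y.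

Lemma class_of_lin a e h e' h' :
  class_of e h -> class_of e' h' -> class_of (a *: e + e') (a *: h + h').
Proof.
move=> [y ye ->] [y' ye' ->]; exists (a *: y + y').
  by rewrite (linearP d0) -ye -ye' (submod_valP _ y y') (submod_valP _ (val y)).
exact/esym/quot_projP.
Qed.

Lemma class_of_exists (e : res_obj E 0) :
  d0 e \in @gamma_pred R m (res_obj E 1) -> exists h, class_of e h.
Proof.
move=> eG; pose y1 : Gamma m (res_obj E 1) := Sub (d0 e) eG.
have y1c : y1 \in @cocycle R _ dGamma 1.
  rewrite unfold_in; apply/eqP/val_inj => /=.
  by apply/(@res_exactS _ _ E); exists e.
by eexists; exists (Sub y1 y1c : cocycles dGamma 1); rewrite ?SubK.
Qed.

Lemma class_of_surj h : exists e, class_of e h /\ d0 e \in @gamma_pred R m (res_obj E 1).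
Proof.
pose y := repr (h : Quotient.quot (submod_pred (@coboundary R _ dGamma 1))).
have [e ye] : exists e, val (val y) = d0 e.
  apply/(@res_exactS _ _ E).
  by have /eqP/(congr1 val) := valP y.
exists e; split; last by rewrite -ye; apply: valP.
by exists y => //; rewrite quot_projK.
Qed.

(** The class vanishes when [d0 e = d0 z] for a torsion [z], and the kernel of [d0] is the image of
    [aug]. *)
Lemma class_of_eq0 e h : class_of e h ->
  h = 0 <-> exists z b, z \in @gamma_pred R m (res_obj E 0) /\ e = z + aug b.
Proof.
move=> [y ye ->]; split=> [/quot_proj_eq0/asboolP[z yz]|[z [b [zG ezb]]]].
  have [b bE] : exists b, e - val z = aug b.
    by apply/(@res_exact0 _ _ E); rewrite linearB -ye yz subrr.
  by exists (val z), b; rewrite -bE addrC subrK; split=> //; apply: valP.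
apply/quot_proj_eq0/asboolP; exists (Sub z zG : Gamma m _).
apply: val_inj; rewrite ye ezb linearD /=.
by rewrite (_ : d0 (aug b) = 0) ?addr0 //; apply/(@res_exact0 _ _ E); exists b.
Qed.

(** [p] sends $b/r$ to the class of [d0 e], where [e] is a quotient of [aug b] by [r] in the
    divisible module [E]; two choices of [e] differ by torsion, which only changes [d0 e] by a
    boundary. *)
Lemma local_cohomology_presents (n : nat) : has_rank B n ->
  exists (T : vectType K) (j : B -> T) (p : T -> local_cohomology m E 1),
    presents j p /\ \dim {:T} = n.
Proof.
move=> [T [t [ttens tZ dimT]]].
have span := tensor_spanned ttens tZ.
have [[tD _ tZl] _] := ttens.
pose j b := t b (1 : K).
have jl r b c : j (r *: b + c) = r%:F *: j b + j c by rewrite /j tD tZl -tZ.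
have j0 : j 0 = 0.
  by have := jl (-1) 0 0; rewrite scaler0 addr0 tofracN tofrac1 scaleN1r addNr.
have jZ r b : j (r *: b) = r%:F *: j b by rewrite -[_ *: b]addr0 jl j0 addr0.
have Einj := @res_injective _ _ E 0.
have jI : injective j.
  move=> b c e; apply/eqP; rewrite -subr_eq0; apply/eqP.
  apply: (tensor_unit_injective hB Einj (@res_aug_inj _ _ E) ttens).
  by rewrite -[t _ _]/(j _) addrC -scaleN1r jl e tofracN tofrac1 scaleN1r addNr.
pose G u h := exists (r : R) b e,
  [/\ r != 0, r%:F *: u = j b, r *: e = aug b & class_of e h].
have Gtotal u : exists h, G u h.
  have [r [b [r0 ru]]] := span u.
  have [e eE] := injective_divisible (aug b) Einj r0.
  have [|h eh] := @class_of_exists e; last by exists h, r, b, e.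
  apply/gamma_torsion; exists r => //; rewrite -linearZ eE.
  by apply/(@res_exact0 _ _ E); exists b.
have Glin a u h u' h' : G u h -> G u' h' -> G (a%:F *: u + u') (a *: h + h').
  move=> [r [b [e [r0 ru re eh]]]] [r' [b' [e' [r'0 ru' re' eh']]]].
  exists (r * r'), ((a * r') *: b + r *: b'), (a *: e + e').
  split; first by rewrite mulf_neq0.
  - rewrite jl jZ -ru -ru' scalerDr !scalerA !tofracM; congr (_ *: _ + _).
    by rewrite mulrC -mulrA [r'%:F * _]mulrC.
  - rewrite [aug _]linearP linearZ /= -re -re' scalerDr !scalerA; congr (_ *: _ + _).
    by rewrite mulrC -mulrA [r' * _]mulrC.
  - exact: class_of_lin.
have G0 h : G 0 h -> h = 0.
  move=> [r [b [e [r0 ru re eh]]]]; apply/(class_of_eq0 eh).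
  exists e, 0; rewrite linear0 addr0; split=> //; apply/gamma_torsion; exists r => //.
  by rewrite re (jI b 0) ?linear0 // j0 -ru scaler0.
have [p pP] := choice Gtotal.
have pG u h : G u h -> p u = h.
  move=> uh; apply/eqP; rewrite -subr_eq0; apply/eqP/G0.
  have := Glin (-1) _ _ _ _ uh (pP u).
  by rewrite tofracN tofrac1 !scaleN1r addNr addrC.
exists T, j, p; split=> //; split=> //.
- by move=> r u u'; apply: pG; apply: Glin.
(* A class comes from some [e] with [d0 e] torsion; a nonzero multiple of [e] then lies in [B]. *)
- move=> h; have [e [eh /gamma_torsion[r r0 re]]] := class_of_surj h.
  have [b eb] : exists b, r *: e = aug b.
    by apply/(@res_exact0 _ _ E); rewrite linearZ.
  exists (r%:F^-1 *: j b); apply: pG; exists r, b, e; split=> //.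
  by rewrite scalerA divff ?scale1r // tofrac_eq0.
move=> u; split=> [pu0|[b ->]]; last first.
  have [|h bh] := @class_of_exists (aug b).
    rewrite (_ : d0 (aug b) = 0) ?rpred0 //.
    by apply/(@res_exact0 _ _ E); exists b.
  have h0 : h = 0.
    by apply/(class_of_eq0 bh); exists 0, b; rewrite rpred0 add0r.
  apply: pG; exists 1, b, (aug b); rewrite oner_neq0 tofrac1 !scale1r.
  by split=> //; rewrite -h0.
(* If $e = z + b_0$ with $s z = 0$, then $s(b - r b_0) = 0$, so $b = r b_0$ and $u = j(b_0)$. *)
have [r [b [e [r0 ru re eh]]]] := pP u.
have [z [b0 [/gamma_torsion[s s0 sz] ezb]]] := (class_of_eq0 eh).1 pu0.
exists b0; suff e0 : b = r *: b0.
  by apply: (scalerI (a := r%:F)); rewrite ?tofrac_eq0 // ru e0 jZ.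
apply/eqP; rewrite -subr_eq0; apply/eqP.
have : s *: (b - r *: b0) = 0.
  apply: (@res_aug_inj _ _ E).
  rewrite linear0 [aug _]linearZ linearB [X in _ - X]linearZ /= -re ezb.
  by rewrite [r *: _]scalerDr addrK scalerA mulrC -scalerA sz scaler0.
by move=> /hB[/eqP|//]; rewrite (negPf s0).
Qed.

End LocalCohomology.

Theorem theorem12p1 (R : idomainType) (m : idealr R)
    (hnoeth : noetherian R) (hlocal : local_ring m)
    (hdim : krull_dim R 1) (hcomplete : adic_complete m)
    (B B' : lmodType R)
    (hB : torsion_free B) (hB' : torsion_free B')
    (n n' : nat) (hrank : has_rank B n) (hrank' : has_rank B' n')
    (E : inj_resolution B) (E' : inj_resolution B')
    (hH : lmod_iso (local_cohomology m E 1) (local_cohomology m E' 1)) :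
  (exists t t' : nat,
      lmod_iso (B * {ffun 'I_t' -> frac_mod R})%type
               (B' * {ffun 'I_t -> frac_mod R})%type) /\
  (n = n' -> lmod_iso B B').
Proof.
have [T [j [p [P dimT]]]] := local_cohomology_presents hnoeth hlocal hdim E hB hrank.
have [T' [j' [p' [P' dimT']]]] :=
  local_cohomology_presents hnoeth hlocal hdim E' hB' hrank'.
split=> [|nn']; last first.
  by apply: (presents_iso hnoeth hlocal hdim hcomplete P P' hH); rewrite dimT dimT'.
(* With truncated subtraction, both sums have rank $\max(n, n')$. *)
exists (n - n')%N, (n' - n)%N.
have [T1 [j1 [p1 [P1 dimT1]]]] := presents_sum_frac (n' - n) P.
have [T1' [j1' [p1' [P1' dimT1']]]] := presents_sum_frac (n - n') P'.
apply: (presents_iso hnoeth hlocal hdim hcomplete P1 P1' hH).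
by rewrite dimT1 dimT1' dimT dimT' -!maxnE maxnC.
Qed.
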